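(* Let $(X,\tau)$ be a Tychonoff space. Then the posets $(\mathcal{L}(X,\tau),\le)$ and $(\mathcal{L}_{ad}(X,\tau),\preceq_{ad})$ are isomorphic.
   Context: Boolean algebras are not required to satisfy $0\neq 1$; the complement of $a$ is written $a^*$. Regular closed sets. For a topological space $X$, $RC(X)=RC(X,\tau)$ is the set of all regular closed subsets ($F=\mathrm{cl}(\mathrm{int}(F))$); it is a complete Boolean algebra with $0=\emptyset$, $1=X$, $F^*=\mathrm{cl}(X\setminus F)$, $F\vee G=F\cup G$, $F\wedge G=\mathrm{cl}(\mathrm{int}(F\cap G))$. Contact algebras. A contact algebra (CA) $(B,C)$ is a Boolean algebra $B$ with a binary relation $C$ such that: (C1) $a\ne 0$ implies $aCa$; (C2) $aCb$ implies $a\neq 0$ and $b\ne 0$; (C3) $aCb$ implies $bCa$; (C4) $aC(b\vee c)$ iff $aCb$ or $aCc$. ''$a(-C)b$'' means ''not $aCb$'', and $a\ll_C b$ means $a(-C)b^*$. Local contact algebras. A local contact algebra (LCA) $(B,\rho,\mathbb{B})$ consists of a CA $(B,\rho)$ and a (possibly non-proper) ideal $\mathbb{B}$ of $B$ such that: (BC1) if $a\in\mathbb{B}$, $c\in B$ and $a\ll_\rho c$, then $a\ll_\rho b\ll_\rho c$ for some $b\in\mathbb{B}$; (BC2) if $a\rho b$ then there is $c\in\mathbb{B}$ with $a\rho(c\wedge b)$; (BC3) if $a\neq 0$ then there is $b\in\mathbb{B}\setminus\{0\}$ with $b\ll_\rho a$. The poset $\mathcal{L}(X)$. A locally compact Hausdorff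 extension (Hausdorff local compactification) of $X$ is a pair $(Y,f)$ with $Y$ locally compact Hausdorff and $f:X\to Y$ a homeomorphic embedding with dense image. Two such extensions $(Y_1,f_1),(Y_2,f_2)$ are equivalent if there is a homeomorphism $h:Y_1\to Y_2$ with $h\circ f_1=f_2$. $\mathcal{L}(X)$ is the set of equivalence classes, ordered by $[(Y_1,f_1)]\le[(Y_2,f_2)]$ iff there is a continuous $h:Y_2\to Y_1$ with $f_1=h\circ f_2$. The poset $\mathcal{L}_{ad}(X)$. An LCA of the form $(RC(X),\rho,\mathbb{B})$ is admissible for $X$ if: (A1) for $F,G\in RC(X)$, $F\cap G\neq\emptyset$ implies $F\rho G$; (A2) if $F\in RC(X)$ and $x\in\mathrm{int}_X(F)$, then there is $G\in\mathbb{B}$ with $x\in\mathrm{int}_X(G)$ and $G\ll_\rho F$. $\mathcal{L}_{ad}(X)$ is the set of all LCAs admissible for $X$, ordered by $(RC(X),\rho_1,\mathbb{B}_1)\preceq_{ad}(RC(X),\rho_2,\mathbb{B}_2)$ iff $\rho_2\subseteq\rho_1$ and $\mathbb{B}_2\subseteq\mathbb{B}_1$. *)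

(* Defs.v *)
From HB Require Import structures.
From mathcomp Require Import all_boot all_order all_algebra.
From mathcomp Require Import all_classical all_reals topology normedtype.

Set Implicit Arguments.
Unset Strict Implicit.
Unset Printing Implicit Defensive.

Import Order.TTheory.
Import numFieldNormedType.Exports.

Local Open Scope classical_set_scope.

(* [completely_regular_space] is phrased in the library with uniform
   separators; [tychonoff_spaceP] gives the form with real functions. *)
Definition tychonoff_space (X : topologicalType) : Prop :=
  hausdorff_space X /\ completely_regular_space X.

Lemma tychonoff_spaceP (R : realType) (X : topologicalType) :
  tychonoff_space X <->
  hausdorff_space X /\
  forall (x : X) (A : set X), closed A -> ~ A x ->
    exists f : X -> R, [/\ continuous f, range f `<=` `[0%R, 1%R],
      f x = 0%R & forall y, A y -> f y = 1%R].
Proof.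
split=> -[hX cX]; split=> // x A cA Ax.
  have /(uniform_separatorP (R := R)) [f [cf f01 f0 f1]] := cX x A cA Ax.
  exists f; split=> //; first by apply: f0; exists x.
  by move=> y Ay; apply: f1; exists y.
have [f [cf f01 f0 f1]] := cX x A cA Ax.
apply/(uniform_separatorP (R := R)); exists f; split=> //.
  by move=> _ [_ -> <-].
by move=> _ [y Ay <-]; exact: f1.
Qed.

Record RC (X : topologicalType) := MkRC {
  RC_set :> set X;
  RC_regclosed : regclosed RC_set }.

Section RC_Boolean.
Variable X : topologicalType.
Implicit Types F G H : RC X.

Lemma RC_inj F G : RC_set F = RC_set G -> F = G.
Proof.
case: F G => [F hF] [G hG] /= eFG; subst G; congr MkRC; exact: Prop_irrelevance.
Qed.

Lemma RC_closed F : closed F.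
Proof. by rewrite -(RC_regclosed F); exact: closed_closure. Qed.

Lemma closure_intS (A B : set X) : A `<=` B -> closure A° `<=` closure B°.
Proof. by move=> AB; apply: closureS; exact: interiorS. Qed.

Lemma regclosed_set0 : regclosed (@set0 X).
Proof. by rewrite /regclosed interior0 closure0. Qed.

Lemma regclosed_setT : regclosed [set: X].
Proof. by rewrite /regclosed interiorT closureT. Qed.

Lemma regclosed_setU F G : regclosed (F `|` G).
Proof.
rewrite /regclosed eqEsubset; split.
  have /closure_id {2}-> : closed (F `|` G) by apply: closedU; exact: RC_closed.
  by apply: closureS; exact: interior_subset.
rewrite -{1}(RC_regclosed F) -{1}(RC_regclosed G) -closureU.
by apply: closureS; exact: interiorU.
Qed.

Lemma regclosed_closure_int (A : set X) : regclosed (closure A°).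
Proof. exact/closure_open_regclosed/open_interior. Qed.

Lemma regclosed_closureC F : regclosed (closure (~` F)).
Proof. by apply: closure_open_regclosed; rewrite openC; exact: RC_closed. Qed.

Definition RC0 : RC X := MkRC regclosed_set0.
Definition RC1 : RC X := MkRC regclosed_setT.
Definition RC_join F G : RC X := MkRC (regclosed_setU F G).
Definition RC_meet F G : RC X := MkRC (regclosed_closure_int (F `&` G)).
Definition RC_compl F : RC X := MkRC (regclosed_closureC F).
Definition RC_le F G : bool := `[< F `<=` G >].

HB.instance Definition _ := gen_eqMixin (RC X).
HB.instance Definition _ := gen_choiceMixin (RC X).

Fact RC_display : Order.disp_t. Proof. exact: (Order.Disp tt tt). Qed.

Lemma RC_le_refl : reflexive RC_le.
Proof. by move=> F; apply/asboolP. Qed.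

Lemma RC_le_anti : antisymmetric RC_le.
Proof.
move=> F G /andP[/asboolP FG /asboolP GF]; apply: RC_inj.
by rewrite eqEsubset; split.
Qed.

Lemma RC_le_trans : transitive RC_le.
Proof.
move=> G F H /asboolP FG /asboolP GH; apply/asboolP; exact: subset_trans GH.
Qed.

HB.instance Definition _ := Order.Le_isPOrder.Build RC_display (RC X)
  RC_le_refl RC_le_anti RC_le_trans.

Lemma RC_lexI F G H :
  (F <= RC_meet G H)%O = (F <= G)%O && (F <= H)%O.
Proof.
apply/asboolP/andP => [FGH|[/asboolP FG /asboolP FH]].
  split; apply/asboolP; apply: (subset_trans FGH) => /=.
    rewrite -[X in _ `<=` X](RC_regclosed G); apply: closure_intS.
    exact: subIsetl.
  rewrite -[X in _ `<=` X](RC_regclosed H); apply: closure_intS.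
  exact: subIsetr.
rewrite -(RC_regclosed F) /=; apply: closure_intS => x Fx.
by split; [exact: FG | exact: FH].
Qed.

Lemma RC_leUx F G H :
  (RC_join F G <= H)%O = (F <= H)%O && (G <= H)%O.
Proof.
apply/asboolP/andP => [FGH|[/asboolP FH /asboolP GH]].
  by split; apply/asboolP => x hx; apply: FGH; [left|right].
by move=> x [/FH|/GH].
Qed.

HB.instance Definition _ :=
  Order.POrder_isMeetSemilattice.Build RC_display (RC X) RC_lexI.
HB.instance Definition _ :=
  Order.POrder_isJoinSemilattice.Build RC_display (RC X) RC_leUx.

Lemma interior_setU_closed (A B : set X) : closed A -> closed B ->
  (A `|` B)° `<=` closure A° `|` closure B°.
Proof.
move=> cA cB x ABx; rewrite -closureU => U Ux.
have [O [oO Ox] OAB] : exists2 O, open_nbhs x O & O `<=` (U `&` (A `|` B)).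
  have : nbhs x (U `&` (A `|` B)) by exact: filterI.
  by rewrite nbhsE => -[O xO sO]; exists O.
have oOA : open (O `\` A) by rewrite setDE; apply: openI => //; rewrite openC.
have [[y OAy]|] := pselect (O `\` A !=set0).
  exists y; split; last by have [/OAB[]] := OAy.
  right; apply: (@interiorS _ (O `\` A)); last first.
    by move/interior_id : oOA => ->.
  by move=> z [Oz Az]; have [_ []] := OAB z Oz.
move=> OA0; exists x; split; last exact: nbhs_singleton.
left; apply: (@interiorS _ O); last by move/interior_id : oO => ->.
move=> z Oz; apply: contrapT => Az; apply: OA0; exists z; split => //.
Qed.

Lemma RC_meetUl : left_distributive RC_meet RC_join.
Proof.
move=> F G H; apply: RC_inj => /=; rewrite setIUl eqEsubset; split.
  have cl (K : RC X) : closed (K `&` H) by apply: closedI; exact: RC_closed.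
  have cU (A B : set X) : closed (closure A `|` closure B).
    by apply: closedU; exact: closed_closure.
  have /closure_id -> := cU (F `&` H)° (G `&` H)°.
  by apply: closureS; exact: interior_setU_closed.
rewrite -closureU; by apply: closureS; exact: interiorU.
Qed.

HB.instance Definition _ :=
  Order.Lattice_Meet_isDistrLattice.Build RC_display (RC X) RC_meetUl.

Lemma RC_le0x F : (RC0 <= F)%O.
Proof. by apply/asboolP; exact: sub0set. Qed.

Lemma RC_lex1 F : (F <= RC1)%O.
Proof. by apply/asboolP; exact: subsetT. Qed.

HB.instance Definition _ := Order.hasBottom.Build RC_display (RC X) RC_le0x.
HB.instance Definition _ := Order.hasTop.Build RC_display (RC X) RC_lex1.

Lemma RC_joinxC F : Order.join F (RC_compl F) = \top%O.
Proof.
apply: RC_inj; rewrite eqEsubset; split=> // x _.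
have [Fx|Fx] := pselect ((F : set X) x); [by left|right].
exact: subset_closure.
Qed.

Lemma RC_meetxC F : Order.meet F (RC_compl F) = \bot%O.
Proof.
apply: RC_inj => /=; rewrite closure_setC.
rewrite interiorI interiorC -[RHS]closure0; congr closure.
rewrite eqEsubset; split=> // x [Fx]; apply.
exact: subset_closure.
Qed.

HB.instance Definition _ :=
  Order.TBDistrLattice_hasComplement.Build RC_display (RC X)
    RC_joinxC RC_meetxC.

End RC_Boolean.

Section Contact.
Local Open Scope order_scope.
Context {d : Order.disp_t} {B : ctbDistrLatticeType d}.
Implicit Types (C rho : B -> B -> Prop) (I BB : B -> Prop) (a b c : B).

Record contact_relation C : Prop := {
  contact_refl : forall a, a != \bot -> C a a;
  contact_neq0 : forall a b, C a b -> a != \bot /\ b != \bot;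
  contact_sym : forall a b, C a b -> C b a;
  contact_join : forall a b c, C a (Order.join b c) <-> C a b \/ C a c }.

(* a <<_C b *)
Definition well_inside C a b : Prop := ~ C a (Order.compl b).

Record order_ideal I : Prop := {
  ideal0 : I \bot;
  ideal_le : forall a b, a <= b -> I b -> I a;
  ideal_join : forall a b, I a -> I b -> I (Order.join a b) }.

Record local_contact rho BB : Prop := {
  lca_contact : contact_relation rho;
  lca_ideal : order_ideal BB;
  lca_BC1 : forall a c, BB a -> well_inside rho a c ->
    exists2 b, BB b & well_inside rho a b /\ well_inside rho b c;
  lca_BC2 : forall a b, rho a b -> exists2 c, BB c & rho a (Order.meet c b);
  lca_BC3 : forall a, a != \bot ->
    exists2 b, BB b /\ b != \bot & well_inside rho b a }.

End Contact.

(* Not [porderType]: the carrier of [Lcal_poset] below lives in a larger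
   universe than the one allowed for a [choiceType]. *)
Record poset := Poset {
  poset_sort :> Type;
  poset_le : poset_sort -> poset_sort -> Prop;
  poset_refl : forall x, poset_le x x;
  poset_anti : forall x y, poset_le x y -> poset_le y x -> x = y;
  poset_trans : forall y x z, poset_le x y -> poset_le y z -> poset_le x z }.

Definition poset_isomorphic (P Q : poset) : Prop :=
  exists f : P -> Q,
    bijective f /\ forall x y, poset_le x y <-> poset_le (f x) (f y).

Definition admissible (X : topologicalType)
    (rho : RC X -> RC X -> Prop) (BB : RC X -> Prop) : Prop :=
  (forall F G : RC X, F `&` G !=set0 -> rho F G) /\
  (forall (F : RC X) (x : X), (F : set X)° x ->
     exists2 G : RC X, BB G & (G : set X)° x /\ well_inside rho G F).

Record Lad (X : topologicalType) := MkLad {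
  Lad_rel : RC X -> RC X -> Prop;
  Lad_bounded : RC X -> Prop;
  Lad_lca : local_contact Lad_rel Lad_bounded;
  Lad_admissible : admissible Lad_rel Lad_bounded }.

Section LadPoset.
Variable X : topologicalType.
Implicit Types l : Lad X.

Definition Lad_le l1 l2 : Prop :=
  (forall F G, Lad_rel l2 F G -> Lad_rel l1 F G) /\
  (forall F, Lad_bounded l2 F -> Lad_bounded l1 F).

Lemma Lad_le_refl l : Lad_le l l.
Proof. by []. Qed.

Lemma Lad_le_anti l1 l2 : Lad_le l1 l2 -> Lad_le l2 l1 -> l1 = l2.
Proof.
case: l1 l2 => [r1 B1 h1 a1] [r2 B2 h2 a2] [/= r21 B21] [/= r12 B12].
have er : r1 = r2.
  by apply/funext => F; apply/funext => G; apply/propext; split => [/r12|/r21].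
have eB : B1 = B2 by apply/funext => F; apply/propext; split => [/B12|/B21].
subst r2 B2; congr MkLad; exact: Prop_irrelevance.
Qed.

Lemma Lad_le_trans l2 l1 l3 : Lad_le l1 l2 -> Lad_le l2 l3 -> Lad_le l1 l3.
Proof.
by move=> [r21 B21] [r32 B32]; split=> [F G /r32/r21|F /B32/B21].
Qed.

Definition Lad_poset : poset :=
  Poset Lad_le_refl Lad_le_anti Lad_le_trans.

End LadPoset.

Definition embedding (X Y : topologicalType) (f : X -> Y) : Prop :=
  [/\ injective f, continuous f &
      forall U, open U -> exists2 V, open V & f @` U = range f `&` V].

Definition homeomorphism (X Y : topologicalType) (h : X -> Y) : Prop :=
  continuous h /\
  exists g : Y -> X, [/\ continuous g, cancel h g & cancel g h].

Record lch_ext (X : topologicalType) := MkExt {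
  ext_space : topologicalType;
  ext_map : X -> ext_space;
  ext_hausdorff : hausdorff_space ext_space;
  ext_lcompact : locally_compact [set: ext_space];
  ext_embedding : embedding ext_map;
  ext_dense : dense (range ext_map) }.

Definition ext_equiv (X : topologicalType) (e1 e2 : lch_ext X) : Prop :=
  exists h : ext_space e1 -> ext_space e2,
    homeomorphism h /\ h \o ext_map e1 = ext_map e2.

Definition ext_le (X : topologicalType) (e1 e2 : lch_ext X) : Prop :=
  exists h : ext_space e2 -> ext_space e1,
    continuous h /\ ext_map e1 = h \o ext_map e2.

(* Not [set (lch_ext X)]: [lch_ext X] lives above the universe of
   [topologicalType], and [set] is monomorphic. *)
Record Lcal (X : topologicalType) := MkLcal {
  Lcal_class : lch_ext X -> Prop;
  Lcal_classP : exists e, Lcal_class = ext_equiv e }.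

Definition Lcal_of (X : topologicalType) (e : lch_ext X) : Lcal X :=
  MkLcal (ex_intro (fun e' => ext_equiv e = ext_equiv e') e erefl).

Definition Lcal_le (X : topologicalType) (c1 c2 : Lcal X) : Prop :=
  exists e1 e2, [/\ Lcal_class c1 e1, Lcal_class c2 e2 & ext_le e1 e2].

Section LPoset.
Variable X : topologicalType.
Implicit Types (e : lch_ext X) (c : Lcal X).

Lemma ext_equiv_refl e : ext_equiv e e.
Proof.
have cid : continuous (@id (ext_space e)) by move=> x; exact: cvg_id.
by exists id; split=> //; split=> //; exists id; split.
Qed.

Lemma ext_equiv_sym e1 e2 : ext_equiv e1 e2 -> ext_equiv e2 e1.
Proof.
move=> [h [[ch [g [cg hg gh]]] hE]]; exists g; split.
  by split=> //; exists h; split.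
by rewrite -hE; apply/funext => x /=; rewrite hg.
Qed.

Lemma comp_continuous (Y1 Y2 Y3 : topologicalType) (f : Y1 -> Y2)
  (g : Y2 -> Y3) : continuous f -> continuous g -> continuous (g \o f).
Proof. by move=> cf cg x; apply: continuous_comp; [exact: cf|exact: cg]. Qed.

Lemma ext_equiv_trans e2 e1 e3 :
  ext_equiv e1 e2 -> ext_equiv e2 e3 -> ext_equiv e1 e3.
Proof.
move=> [h [[ch [g [cg hg gh]]] hE]] [k [[ck [l [cl kl lk]]] kE]].
exists (k \o h); split; last by rewrite -kE -hE.
split; first exact: comp_continuous.
exists (g \o l); split; [exact: comp_continuous| |].
- by move=> x /=; rewrite kl hg.
- by move=> x /=; rewrite gh lk.
Qed.

Lemma ext_equiv_le e1 e2 : ext_equiv e1 e2 -> ext_le e1 e2.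
Proof. by move=> /ext_equiv_sym[h [[ch _] hE]]; exists h. Qed.

Lemma ext_le_trans e2 e1 e3 : ext_le e1 e2 -> ext_le e2 e3 -> ext_le e1 e3.
Proof.
move=> [h [ch hE]] [k [ck kE]]; exists (h \o k); split.
  exact: comp_continuous.
by rewrite hE kE.
Qed.

Lemma ext_endo_id e (h : ext_space e -> ext_space e) :
  continuous h -> h \o ext_map e = ext_map e -> h =1 id.
Proof.
move=> ch hE y; apply: contrapT => /eqP hy.
have := @ext_hausdorff X e; rewrite open_hausdorff => /(_ _ _ hy).
move=> [[U V] /= [/set_mem Uhy /set_mem Vy] [oU oV UV0]].
have oW : open (h @^-1` U `&` V).
  by apply: openI => //; apply: open_comp => // z _; exact: ch.
have [|z [[Uz Vz] [x _ xz]]] := @ext_dense X e _ _ oW; first by exists y.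
have hz : h z = z by rewrite -xz -[LHS]/((h \o ext_map e) x) hE.
have UVz : (U `&` V) z by split=> //; rewrite -hz.
by rewrite (eqP UV0) in UVz.
Qed.

Lemma ext_le_anti e1 e2 : ext_le e1 e2 -> ext_le e2 e1 -> ext_equiv e1 e2.
Proof.
move=> [h [ch hE]] [k [ck kE]]; exists k; split=> //; split=> //.
exists h; split=> //.
- by apply: ext_endo_id; [exact: comp_continuous|rewrite -compA -kE -hE].
- by apply: ext_endo_id; [exact: comp_continuous|rewrite -compA -hE -kE].
Qed.

Lemma Lcal_of_eq e1 e2 : Lcal_of e1 = Lcal_of e2 <-> ext_equiv e1 e2.
Proof.
split=> [[e12]|e12]; first by rewrite e12; exact: ext_equiv_refl.
have eE : ext_equiv e1 = ext_equiv e2.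
  apply/funext => e; apply/propext; split; last exact: ext_equiv_trans.
  exact/ext_equiv_trans/ext_equiv_sym.
rewrite /Lcal_of; move: (ex_intro _ _ _) (ex_intro _ _ _).
rewrite eE => p q; congr MkLcal; exact: Prop_irrelevance.
Qed.

Lemma Lcal_of_surj c : exists e, c = Lcal_of e.
Proof.
case: c => C [e Ce]; exists e; subst C; congr MkLcal; exact: Prop_irrelevance.
Qed.

Lemma Lcal_leE e1 e2 : Lcal_le (Lcal_of e1) (Lcal_of e2) <-> ext_le e1 e2.
Proof.
split=> [[e1' [e2' [/= h1 h2 h]]]|h]; last first.
  by exists e1, e2; split=> //=; exact: ext_equiv_refl.
apply: ext_le_trans (ext_equiv_le h1) _.
exact: ext_le_trans h (ext_equiv_le (ext_equiv_sym h2)).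
Qed.

Lemma Lcal_le_refl c : Lcal_le c c.
Proof.
have [e ->] := Lcal_of_surj c; apply/Lcal_leE.
exact/ext_equiv_le/ext_equiv_refl.
Qed.

Lemma Lcal_le_anti c1 c2 : Lcal_le c1 c2 -> Lcal_le c2 c1 -> c1 = c2.
Proof.
have [e1 ->] := Lcal_of_surj c1; have [e2 ->] := Lcal_of_surj c2.
by move=> /Lcal_leE h12 /Lcal_leE h21; apply/Lcal_of_eq; exact: ext_le_anti.
Qed.

Lemma Lcal_le_trans c2 c1 c3 : Lcal_le c1 c2 -> Lcal_le c2 c3 -> Lcal_le c1 c3.
Proof.
have [e1 ->] := Lcal_of_surj c1; have [e2 ->] := Lcal_of_surj c2.
have [e3 ->] := Lcal_of_surj c3.
move=> /Lcal_leE h12 /Lcal_leE h23; apply/Lcal_leE; exact: ext_le_trans h23.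
Qed.

Definition Lcal_poset : poset := Poset Lcal_le_refl Lcal_le_anti Lcal_le_trans.

End LPoset.

(* Main.v *)
Require Import Defs.
From HB Require Import structures.
From mathcomp Require Import all_boot all_order all_algebra.
From mathcomp Require Import all_classical all_reals topology normedtype.

(** Both directions of the correspondence go through closures in the extension.

    From an extension f : X -> Y, regular closed sets F and G of X are declared
    near when the closures of their images in Y meet, and F is declared bounded
    when the closure of its image is compact. As X is dense in Y, taking that
    closure identifies the regular closed sets of X with those of Y, complements
    included ([ext_closureC]); so F is well inside G exactly when the closure of
    F lies in the interior of the closure of G ([ext_well_insideP]), and the
    axioms (BC1)-(BC3), (A1), (A2) become the usual shrinking properties of a
    locally compact Hausdorff space.

    This assignment preserves and reflects the orders. A continuous map
    Y2 -> Y1 over X carries closures to closures and compact sets to compact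
    sets. Conversely, suppose that the relation and the ideal of Y1 contain
    those of Y2, and take y in Y2. A bounded neighbourhood of y gives a compact
    subset of Y1 on which the images of the traces of the neighbourhoods of y
    accumulate; by the inclusion of the relations, an accumulation point is a
    limit ([Lad_of_ext_limit]). Sending y to this limit is continuous by
    regularity of Y1.

    It remains to realise an arbitrary admissible structure. The points of the
    extension are the ends of the algebra: proper filters nu that are round,
    contain a bounded element, and decide between the complement of a and b
    whenever a is well inside b. They stand for the sets
    {F | y is interior to the closure of F}. The sets {nu | a in nu} form a base
    of a Hausdorff topology, and for a bounded the closed set
    {nu | the complement of a is not in nu} is compact: an ultrafilter on the
    space converges to the end made of the elements that lie well above a
    bounded h with {nu | h in nu} in the ultrafilter ([end_of_filter],
    [compact_end_closure]). A point x of X gives the end {F | x in int F}; here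
    (A2) yields roundness and boundedness, and (A1) the decision property.
    The closure of the image of F is {nu | F^* not in nu}
    ([closure_point_end]), and compactness of these sets for bounded F gives
    back the relation and the ideal ([Lad_relP], [Lad_boundedP]). *)

Set Implicit Arguments.
Unset Strict Implicit.
Unset Printing Implicit Defensive.

Import Order.Theory.

Local Open Scope classical_set_scope.

(** * Compactness and regularity *)

Section Topology.
Variable T : topologicalType.

(** Directedness replaces the finite subcover by a single member. With no such
    member the sets [K `\` b i] generate a proper filter, and a cluster point of
    it escapes the whole family. *)
Lemma compact_directed_cover (I : Type) (D : set I) (b : I -> set T)
    (K : set T) :
  compact K -> D !=set0 -> (forall i, D i -> open (b i)) ->
  (forall i j, D i -> D j -> exists2 k, D k & b i `|` b j `<=` b k) ->
  K `<=` \bigcup_(i in D) b i -> exists2 i, D i & K `<=` b i.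
Proof.
move=> cK [i0 Di0] ob db Kb; apply: contrapT => nK.
pose F := filter_from D (fun i => K `\` b i).
have FF : ProperFilter F.
  apply: filter_from_proper.
    apply: filter_from_filter; first by exists i0.
    move=> i j Di Dj; have [k Dk bk] := db i j Di Dj.
    by exists k => // x [Kx bx]; split; split => // ?; apply: bx; apply: bk;
      [left|right].
  move=> i Di; apply: contrapT => KDb0; apply: nK; exists i => // x Kx.
  by apply: contrapT => nbx; apply: KDb0; exists x.
have [|x [Kx clx]] := cK F FF; first by exists i0 => // x [].
have [i Di bix] := Kb x Kx.
have xbi : nbhs x (b i) by apply: open_nbhs_nbhs; split=> //; exact: ob.
have [|y [[_ nby] //]] := clx (K `\` b i) (b i) _ xbi.
by exists i.
Qed.

Hypotheses (hT : hausdorff_space T) (lT : locally_compact [set: T]).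

Lemma lch_shrink (x : T) (U : set T) : nbhs x U ->
  exists V, [/\ open V, V x, compact (closure V) & closure V `<=` U].
Proof.
move=> xU; have [K] := @lT x Logic.I; rewrite withinET => xK [cK clK].
have [|V xV VUK] := @compact_regular T x K hT cK xK (U `&` K).
  exact: filterI.
exists V°; split; [exact: open_interior|exact: xV| |].
- apply: (subclosed_compact _ cK); first exact: closed_closure.
  by move=> y /(closureS (@interior_subset _ _))/VUK[].
- by move=> y /(closureS (@interior_subset _ _))/VUK[].
Qed.

(** The open sets with compact closure inside [U] are closed under finite
    unions, so they cover [K] as a directed family. *)
Lemma lch_compact_shrink (K U : set T) : compact K -> open U -> K `<=` U ->
  exists V, [/\ open V, K `<=` V, compact (closure V) & closure V `<=` U].
Proof.
move=> cK oU KU.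
pose D := [set V : set T | [/\ open V, compact (closure V) & closure V `<=` U]].
have [||V W|x Kx|V [oV cV VU] KV] := @compact_directed_cover _ D id K cK.
- exists set0; split; [exact: open0| |]; rewrite closure0 //.
  exact: compact0.
- by move=> V [].
- move=> [oV cV VU] [oW cW WU]; exists (V `|` W) => //; split.
  + exact: openU.
  + by rewrite closureU; exact: compactU.
  + by rewrite closureU => x [/VU|/WU].
- have [V [oV Vx cV VU]] := lch_shrink (open_nbhs_nbhs (conj oU (KU x Kx))).
  by exists V.
- by exists V.
Qed.

End Topology.

(** A uniform separator is a coarser uniform topology, and uniform spaces are
    regular; closures only shrink when passing back to the finer topology. *)
Lemma completely_regular_regular_space (T : topologicalType) :
  completely_regular_space T -> regular_space T.
Proof.
move=> crT x U /nbhs_interior xU.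
have [||uT [A [entA xUA sub]]] := crT x (~` U°).
- exact/open_closedC/open_interior.
- by apply; exact: nbhs_singleton.
pose UT := Uniform.Pack uT.
have xU' : @nbhs UT UT x U.
  apply/nbhsP; exists A => // z /xsectionP xz.
  apply: (@interior_subset T); apply: contrapT => nUz.
  suff : (set0 : set (T * T)) (x, z) by [].
  by rewrite -xUA.
have [V xV VU] := @separation_axioms.uniform_regular UT x U xU'.
exists V; first exact: sub.
by move=> z clz; apply: VU => W zW; apply: clz; exact: sub.
Qed.

(** * Regular closed sets *)

Section RegularClosed.
Variable X : topologicalType.

Lemma RC_neq0 (F : RC X) : F != \bot%O -> (F : set X)° !=set0.
Proof.
move=> F0; apply: contrapT => /set0P/negP/negPn/eqP iF0; move/eqP: F0; apply.
by apply: RC_inj; rewrite -(RC_regclosed F) iF0 closure0.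
Qed.

Lemma neq0_RC (F : RC X) : F !=set0 -> F != \bot%O.
Proof. by move=> [x Fx]; apply/eqP => F0; move: Fx; rewrite F0. Qed.

Lemma int_RC_meet (F G : RC X) :
  (F : set X)° `&` (G : set X)° `<=` ((F `&` G)%O : RC X)°.
Proof.
move=> x; rewrite -interiorI => FGx; apply: filterS (nbhs_interior FGx).
exact: subset_closure.
Qed.

Lemma RC_leP (F G : RC X) : reflect (F `<=` G) (F <= G)%O.
Proof. exact: asboolP. Qed.

Lemma int_RC_compl (F : RC X) : ((~` F)%O : RC X)° = ~` (F : set X).
Proof. by rewrite [X in X°]closure_setC interiorC RC_regclosed. Qed.

End RegularClosed.

(** * The local contact algebra of an extension *)

Section ExtLCA.
Variables (X : topologicalType) (e : lch_ext X).
Notation Y := (ext_space e).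
Notation f := (@ext_map X e).

Definition ext_closure (A : set X) : set Y := closure (f @` A).

(** Defined for every set, so that no proof that [V] is open enters the term. *)
Definition ext_trace (V : set Y) : RC X :=
  MkRC (regclosed_closure_int (f @^-1` V)).

Lemma ext_continuous : continuous f.
Proof. by have [] := @ext_embedding X e. Qed.

Lemma open_ext_preimage (V : set Y) : open V -> open (f @^-1` V).
Proof. by move=> oV; apply: open_comp => // x _; exact: ext_continuous. Qed.

Lemma ext_closureS (A B : set X) :
  A `<=` B -> ext_closure A `<=` ext_closure B.
Proof. by move=> AB; apply/closureS/image_subset. Qed.

Lemma ext_closureU (A B : set X) :
  ext_closure (A `|` B) = ext_closure A `|` ext_closure B.
Proof. by rewrite /ext_closure image_setU closureU. Qed.

Lemma mem_ext_closure (A : set X) x : A x -> ext_closure A (f x).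
Proof. by move=> Ax; apply: subset_closure; exists x. Qed.

Lemma ext_open_lift (U : set X) : open U ->
  exists V, open V /\ f @^-1` V = U.
Proof.
have [fI _ fO] := @ext_embedding X e; move=> /fO[V oV fUV].
exists V; split=> //; rewrite eqEsubset; split=> x.
  move=> Vx; have : (f @` U) (f x) by rewrite fUV; split=> //; exists x.
  by move=> [z Uz /fI <-].
by move=> Ux; have [] : (range f `&` V) (f x) by rewrite -fUV; exists x.
Qed.

Lemma ext_closure_preimage (A : set X) : closed A ->
  f @^-1` ext_closure A = A.
Proof.
move=> cA; rewrite eqEsubset; split=> [x|x]; last exact: mem_ext_closure.
move=> /= clx; apply: contrapT => nAx.
have [V [oV fV]] := ext_open_lift (closed_openC cA).
have [|_ [[z Az <-] Vz]] := clx V.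
  by apply: open_nbhs_nbhs; split=> //; rewrite -[V (f x)]/((f @^-1` V) x) fV.
by have : (~` A) z by rewrite -fV.
Qed.

Lemma open_ext_closure (V : set Y) : open V ->
  V `<=` ext_closure (f @^-1` V).
Proof.
move=> oV y Vy U; rewrite nbhsE => -[W [oW Wy] WU].
have [|z [[Wz Vz] [x _ xz]]] := @ext_dense X e (W `&` V) _ (openI oW oV).
  by exists y.
by subst z; exists (f x); split; [exists x|exact: WU].
Qed.

Lemma ext_closure_closure (A : set X) :
  ext_closure (closure A) = ext_closure A.
Proof.
rewrite eqEsubset; split; last exact/ext_closureS/subset_closure.
rewrite [X in _ `<=` X]((closure_id _).1 (@closed_closure _ _)).
apply: closureS => _ [x clx <-] U xU.
have [z [Az Uz]] := clx _ (ext_continuous xU).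
by exists (f z); split=> //; exists z.
Qed.

(** The way back from open sets of the extension to regular closed sets of [X]:
    density of [X] ensures that nothing of [V] is lost. *)
Lemma ext_closure_trace (V : set Y) : open V ->
  ext_closure (ext_trace V) = closure V.
Proof.
move=> oV; rewrite /= ext_closure_closure.
rewrite (interior_id _).1; last exact: open_ext_preimage.
rewrite eqEsubset; split.
  by apply: closureS => _ [x Vx <-].
rewrite [X in _ `<=` X]((closure_id _).1 (@closed_closure _ _)).
exact/closureS/open_ext_closure.
Qed.

Lemma sub_ext_trace (V : set Y) : open V ->
  f @^-1` V `<=` (ext_trace V : set X)°.
Proof.
move=> oV; have oU := open_ext_preimage oV.
rewrite -{1}((interior_id _).1 oU) -[X in X° `<=` _]((interior_id _).1 oU).
exact/interiorS/subset_closure.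
Qed.

(** Since [ext_closure F] has trace [F] on [X], the open set [~` ext_closure F]
    has trace [~` F], which is dense in it. *)
Lemma ext_closureC (F : RC X) :
  ext_closure (Order.compl F) = ~` (ext_closure F)°.
Proof.
rewrite -closure_setC [LHS]ext_closure_closure eqEsubset.
have pC : f @^-1` (~` ext_closure F) = ~` F.
  by rewrite -preimage_setC ext_closure_preimage//; exact: RC_closed.
split.
  apply: closureS => _ [x Fx <-].
  by rewrite -[(~` _) _]/((f @^-1` (~` ext_closure F)) x) pC.
rewrite [X in _ `<=` X]((closure_id _).1 (@closed_closure _ _)) -pC.
by apply/closureS/open_ext_closure/closed_openC/closed_closure.
Qed.

Definition ext_rel (F G : RC X) : Prop :=
  ext_closure F `&` ext_closure G !=set0.

Definition ext_bounded (F : RC X) : Prop := compact (ext_closure F).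

Lemma ext_well_insideP (F G : RC X) :
  well_inside ext_rel F G <-> ext_closure F `<=` (ext_closure G)°.
Proof.
rewrite /well_inside /ext_rel ext_closureC; split=> [nFG y Fy|FG [y [/FG]]//].
by apply: contrapT => Gy; apply: nFG; exists y.
Qed.

Lemma ext_contact : contact_relation ext_rel.
Proof.
split.
- move=> F /RC_neq0[x /interior_subset Fx]; exists (f x).
  by split; exact: mem_ext_closure.
- have ne (F : RC X) : ext_closure F !=set0 -> F != \bot%O.
    move=> [y Fy]; apply/eqP => F0; move: Fy.
    by rewrite F0 /ext_closure /= image_set0 closure0.
  by move=> F G [y [Fy Gy]]; split; apply: ne; exists y.
- by move=> F G [y [Fy Gy]]; exists y.
- move=> F G H; rewrite /ext_rel ext_closureU setIUr; split.
    by move=> [y [FG|FH]]; [left|right]; exists y.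
  by move=> [[y FG]|[y FH]]; exists y; [left|right].
Qed.

Lemma ext_ideal : order_ideal ext_bounded.
Proof.
split.
- by rewrite /ext_bounded /ext_closure /= image_set0 closure0; exact: compact0.
- move=> F G /asboolP FG cG; apply: (subclosed_compact _ cG).
    exact: closed_closure.
  exact: ext_closureS.
- by move=> F G cF cG; rewrite /ext_bounded ext_closureU; exact: compactU.
Qed.

(** Axiom (A2), which also yields (BC3): the trace of a small neighbourhood of
    [f x] in the extension is a bounded neighbourhood of [x]. *)
Lemma ext_bounded_nbhs (F : RC X) (x : X) : (F : set X)° x ->
  exists2 G : RC X, ext_bounded G &
    (G : set X)° x /\ well_inside ext_rel G F.
Proof.
move=> Fx; have [V [oV fV]] := ext_open_lift (@open_interior _ (F : set X)).
have Vx : V (f x) by rewrite -[V _]/((f @^-1` V) x) fV.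
have [W [oW Wx cW WV]] := lch_shrink (@ext_hausdorff X e) (@ext_lcompact X e)
  (open_nbhs_nbhs (conj oV Vx)).
exists (ext_trace W); first by rewrite /ext_bounded ext_closure_trace.
split; first exact: sub_ext_trace.
apply/ext_well_insideP; rewrite ext_closure_trace//; apply: (subset_trans WV).
rewrite -{1}((interior_id _).1 oV); apply: interiorS.
apply: subset_trans (open_ext_closure oV) _; rewrite fV.
by apply: ext_closureS; exact: interior_subset.
Qed.

Lemma ext_lca : local_contact ext_rel ext_bounded.
Proof.
split; [exact: ext_contact|exact: ext_ideal| | |].
- move=> F G cF /ext_well_insideP FG.
  have [V [oV FV cV VG]] := lch_compact_shrink (@ext_hausdorff X e)
    (@ext_lcompact X e) cF (@open_interior _ _) FG.
  exists (ext_trace V); first by rewrite /ext_bounded ext_closure_trace.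
  split; apply/ext_well_insideP; rewrite ext_closure_trace//.
  apply: (subset_trans FV); rewrite -{1}((interior_id _).1 oV).
  exact/interiorS/subset_closure.
- move=> F G [y [Fy Gy]].
  have [V [oV Vy cV _]] := lch_shrink (@ext_hausdorff X e)
    (@ext_lcompact X e) (@filterT _ (nbhs y) _).
  exists (ext_trace V); first by rewrite /ext_bounded ext_closure_trace.
  exists y; split=> //; rewrite [ext_closure _]ext_closure_closure => U yU.
  (* [U] meets the closure of [G] inside [V]; as [G] is the closure of its
     interior, the meeting point can be moved into the interior of the meet of
     [G] with the trace of [V]. *)
  have [|_ [[x Gx <-] [Ux Vx]]] := Gy (U° `&` V).
    apply: open_nbhs_nbhs; split=> //; apply: openI => //.
    exact: open_interior.
  have oUV : open (f @^-1` (U° `&` V)).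
    by apply: open_ext_preimage; apply: openI => //; exact: open_interior.
  move: Gx; rewrite -{1}(RC_regclosed G) => /(_ (f @^-1` (U° `&` V))) [|z].
    exact: open_nbhs_nbhs.
  move=> [Gz [Uz Vz]]; exists (f z); split; last exact: interior_subset.
  by exists z => //; rewrite interiorI; split=> //; exact: sub_ext_trace.
- move=> F /RC_neq0[x /ext_bounded_nbhs[G cG [Gx GF]]].
  exists G => //; split=> //; apply: neq0_RC; exists x.
  exact: interior_subset.
Qed.

Lemma ext_admissible : admissible ext_rel ext_bounded.
Proof.
split; last exact: ext_bounded_nbhs.
by move=> F G [x [Fx Gx]]; exists (f x); split; exact: mem_ext_closure.
Qed.

Definition Lad_of_ext : Lad X := MkLad ext_lca ext_admissible.

End ExtLCA.

Arguments ext_closure {X} e A.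
Arguments ext_rel {X} e F G.
Arguments ext_bounded {X} e F.
Arguments ext_closure_preimage {X} e [A].

(** * Comparing extensions through their local contact algebras *)

Section Order.
Variables (X : topologicalType) (e1 e2 : lch_ext X).

(** A map over [X] sends the closure of [F] in the second extension into its
    closure in the first, and onto it when the former is compact, the image
    being then closed. *)
Lemma Lad_of_ext_mono : ext_le e1 e2 -> Lad_le (Lad_of_ext e1) (Lad_of_ext e2).
Proof.
move=> [h [ch hE]].
have him (A : set X) : h @` ext_closure e2 A `<=` ext_closure e1 A.
  move=> _ [y Ay <-] U /ch yU; have [_ [[x Ax <-] Ux]] := Ay _ yU.
  by exists (ext_map e1 x); split; [exists x|rewrite hE].
split=> [F G [y [Fy Gy]]|F cF].
  by exists (h y); split; apply: him; exists y.
have cHF : compact (h @` ext_closure e2 F).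
  by apply: continuous_compact => //; exact: continuous_subspaceT.
rewrite /= /ext_bounded (_ : ext_closure e1 F = h @` ext_closure e2 F)//.
rewrite eqEsubset; split=> //.
have /closure_id -> := compact_closed (@ext_hausdorff X e1) cHF.
apply: closureS => _ [x Fx <-]; rewrite hE; exists (ext_map e2 x) => //.
exact: mem_ext_closure.
Qed.

(** The trace of a bounded neighbourhood of [y] has compact closure in the first
    extension, which provides an accumulation point [p]. If the closure of [W2]
    lies in [W1] around [p], the trace of [W2] is well inside that of [W1] for
    the first extension, hence for the second. As [y] adheres to the trace of
    [W2], it is interior to the closure of the trace of [W1], so the
    accumulation point is a limit. *)
Lemma Lad_of_ext_limit (y : ext_space e2) :
  Lad_le (Lad_of_ext e1) (Lad_of_ext e2) ->
  exists p : ext_space e1, forall W, nbhs p W ->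
    exists2 U, nbhs y U & ext_map e2 @^-1` U `<=` ext_map e1 @^-1` W.
Proof.
move=> [/= rle ble].
have [V [oV Vy cV _]] := lch_shrink (@ext_hausdorff X e2)
  (@ext_lcompact X e2) (@filterT _ (nbhs y) _).
have /ble cF : ext_bounded e2 (ext_trace V).
  by rewrite /ext_bounded ext_closure_trace.
pose Phi := filter_from (nbhs y) (fun U => ext_map e1 @` (ext_map e2 @^-1` U)).
have PhiP : ProperFilter Phi.
  apply: filter_from_proper; last first.
    move=> U; rewrite nbhsE => -[O [oO Oy] OU].
    have [|z [Oz [x _ xz]]] := @ext_dense X e2 O _ oO; first by exists y.
    rewrite -xz in Oz; exists (ext_map e1 x), x => //; exact: OU.
  apply: filter_from_filter; first by exists setT; exact: filterT.
  move=> U U' yU yU'; exists (U `&` U'); first exact: filterI.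
  by move=> _ [x [Ux U'x] <-]; split; exists x.
have [|p [_ clp]] := cF Phi PhiP.
  exists V; first exact: open_nbhs_nbhs.
  move=> _ [x Vx <-]; apply: mem_ext_closure.
  exact: (interior_subset (sub_ext_trace oV Vx)).
exists p => W pW.
have [W1 [oW1 W1p _ W1W]] := lch_shrink (@ext_hausdorff X e1)
  (@ext_lcompact X e1) pW.
have [W2 [oW2 W2p _ W2W1]] := lch_shrink (@ext_hausdorff X e1)
  (@ext_lcompact X e1) (open_nbhs_nbhs (conj oW1 W1p)).
have /ext_well_insideP W21 :
    well_inside (ext_rel e2) (ext_trace W2) (ext_trace W1).
  suff /ext_well_insideP s : ext_closure e1 (ext_trace W2) `<=`
      (ext_closure e1 (ext_trace W1))° by move=> /rle.
  rewrite !ext_closure_trace//; apply: (subset_trans W2W1).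
  rewrite -{1}((interior_id _).1 oW1); exact/interiorS/subset_closure.
exists (ext_closure e2 (ext_trace W1))°.
  apply: open_nbhs_nbhs; split; first exact: open_interior.
  apply: W21 => U yU.
  have [||_ [[x Ux <-] W2x]] := clp (ext_map e1 @` (ext_map e2 @^-1` U)) W2.
  - by exists U.
  - exact: open_nbhs_nbhs.
  exists (ext_map e2 x); split=> //; exists x => //.
  exact: (interior_subset (sub_ext_trace oW2 W2x)).
move=> x /interior_subset W1x; apply: W1W; rewrite -ext_closure_trace//.
apply: mem_ext_closure.
rewrite -(ext_closure_preimage e2 (@RC_closed _ (ext_trace W1))).
exact: W1x.
Qed.

Lemma ext_le_of_Lad_le :
  Lad_le (Lad_of_ext e1) (Lad_of_ext e2) -> ext_le e1 e2.
Proof.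
move=> le12; have [h hP] := choice (fun y => Lad_of_ext_limit y le12).
exists h; split.
- move=> y W yW.
  have [W' [oW' W'y _ W'W]] := lch_shrink (@ext_hausdorff X e1)
    (@ext_lcompact X e1) yW.
  have [U yU UW'] := hP y W' (open_nbhs_nbhs (conj oW' W'y)).
  apply: filterS (nbhs_interior yU) => y' y'U; apply: W'W => A y'A.
  have [U' y'U' U'A] := hP y' A y'A.
  have : nbhs y' (U `&` U') by exact: filterI.
  rewrite nbhsE => -[O [oO Oy'] OUU'].
  have [|z [Oz [x _ xz]]] := @ext_dense X e2 O _ oO; first by exists y'.
  rewrite -xz in Oz; have [Ux U'x] := OUU' _ Oz.
  by exists (ext_map e1 x); split; [exact: UW'|exact: U'A].
- apply/funext => x /=; apply/esym/(@ext_hausdorff X e1) => A B pA xB.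
  have [U xU UA] := hP _ A pA.
  exists (ext_map e1 x); split; last exact: nbhs_singleton.
  by apply: UA; exact: nbhs_singleton xU.
Qed.

End Order.

(** * Contact algebras *)

Section ContactTheory.
Context {d : Order.disp_t} {B : ctbDistrLatticeType d}.
Variable rho : B -> B -> Prop.
Hypothesis rhoC : contact_relation rho.
Implicit Types a b c : B.

Lemma contact_le a a' b b' :
  (a <= a')%O -> (b <= b')%O -> rho a b -> rho a' b'.
Proof.
move=> /join_r aa' /join_r bb' ab.
have ab' : rho a b' by rewrite -bb'; apply/(contact_join rhoC); left.
apply: (contact_sym rhoC); rewrite -aa'; apply/(contact_join rhoC); left.
exact: (contact_sym rhoC).
Qed.

Lemma well_inside_mono a' a b b' :
  (a' <= a)%O -> (b <= b')%O -> well_inside rho a b -> well_inside rho a' b'.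
Proof.
by move=> aa' bb' nab ab; apply: nab; apply: contact_le ab; rewrite ?leC.
Qed.

Lemma well_inside_le a b : well_inside rho a b -> (a <= b)%O.
Proof.
move=> ab; rewrite -[b]complK -disj_leC; apply/negPn/negP => ab0.
apply: ab; apply: contact_le (contact_refl rhoC ab0); first exact: leIl.
exact: leIr.
Qed.

Lemma well_inside_compl a b :
  well_inside rho a b -> well_inside rho (~` b)%O (~` a)%O.
Proof. by move=> nab; rewrite /well_inside complK => /(contact_sym rhoC). Qed.

Lemma well_inside_meetr a b c :
  well_inside rho a b -> well_inside rho a c -> well_inside rho a (b `&` c)%O.
Proof.
by move=> ab ac; rewrite /well_inside complI => /(contact_join rhoC)[].
Qed.

Lemma well_inside_joinl a b c :
  well_inside rho a c -> well_inside rho b c -> well_inside rho (a `|` b)%O c.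
Proof.
move=> ac bc /(contact_sym rhoC)/(contact_join rhoC).
by case=> /(contact_sym rhoC).
Qed.

Lemma well_insidex1 a : well_inside rho a \top%O.
Proof.
by rewrite /well_inside compl1 => /(contact_neq0 rhoC)[_]; rewrite eqxx.
Qed.

End ContactTheory.

Arguments well_insidex1 {d B rho} rhoC a : rename.

(** * The space of ends of a local contact algebra *)

(** An end plays the role of a point [y] through the elements [a] having [y]
    in the interior of their closure. The condition [end_prime] makes these
    filters maximal ([end_eq]), in a form suited to ultrafilter arguments. *)
Record lca_end (d : Order.disp_t) (B : ctbDistrLatticeType d)
    (rho : B -> B -> Prop) (BB : B -> Prop) := MkEnd {
  end_mem :> B -> Prop;
  end_proper : ~ end_mem \bot%O;
  end_meet : forall a b, end_mem a -> end_mem b -> end_mem (a `&` b)%O;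
  end_le : forall a b, (a <= b)%O -> end_mem a -> end_mem b;
  end_round : forall a, end_mem a -> exists2 b, end_mem b & well_inside rho b a;
  end_bounded : exists2 a, BB a & end_mem a;
  end_prime : forall a b,
    well_inside rho a b -> end_mem (~` a)%O \/ end_mem b }.

Section EndSpace.
Context {d : Order.disp_t} {B : ctbDistrLatticeType d}.
Variables (rho : B -> B -> Prop) (BB : B -> Prop).
Notation E := (lca_end rho BB).

HB.instance Definition _ := gen_eqMixin E.
HB.instance Definition _ := gen_choiceMixin E.

Definition end_nbhd (a : B) : set E := [set nu | nu a].

Definition end_open (U : set E) : Prop :=
  forall nu, U nu -> exists2 a, nu a & end_nbhd a `<=` U.

Let end_openT : end_open setT.
Proof. by move=> nu _; have [a _ nua] := end_bounded nu; exists a. Qed.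

Let end_openI : setI_closed end_open.
Proof.
move=> U V oU oV nu [/oU[a nua aU] /oV[b nub bV]].
exists (a `&` b)%O; first exact: end_meet.
move=> mu muab; split; [apply: aU|apply: bV]; apply: end_le muab.
  exact: leIl.
exact: leIr.
Qed.

Let end_open_bigU (I : Type) (f : I -> set E) :
  (forall i, end_open (f i)) -> end_open (\bigcup_i f i).
Proof.
move=> fo nu [i _ /fo[a nua af]]; exists a => // mu /af fi; by exists i.
Qed.

HB.instance Definition _ := isOpenTopological.Build E
  end_openT end_openI end_open_bigU.

Lemma open_end_nbhd a : open (end_nbhd a).
Proof. by move=> nu nua; exists a. Qed.

Lemma nbhs_endP (nu : E) (U : set E) :
  nbhs nu U <-> exists2 a, nu a & end_nbhd a `<=` U.
Proof.
rewrite nbhsE; split=> [[V [oV Vnu] VU]|[a nua aU]].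
  by have [a nua aV] := oV nu Vnu; exists a => //; exact: subset_trans VU.
by exists (end_nbhd a) => //; split=> //; exact: open_end_nbhd.
Qed.

Lemma end_compl (nu : E) a : nu a -> ~ nu (~` a)%O.
Proof.
move=> nua nuCa; apply: (end_proper (l := nu)); rewrite -(meetxC a).
exact: end_meet.
Qed.

(** Ends are maximal: if [b] is well inside [a] and [b] belongs to the larger
    end, the smaller one cannot contain the complement of [b], so it contains
    [a]. *)
Lemma end_eq (nu mu : E) : (forall a, nu a -> mu a) -> nu = mu.
Proof.
move=> sub.
have eq_mem : end_mem nu = end_mem mu.
  apply/funext => a; apply/propext; split; first exact: sub.
  move=> /end_round[b mub ba]; case: (end_prime nu ba) => // /sub muCb.
  by case: (end_compl mub muCb).
case: nu mu eq_mem {sub} => [n ? ? ? ? ? ?] [m ? ? ? ? ? ?] /= nm; subst m.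
by congr MkEnd; exact: Prop_irrelevance.
Qed.

Lemma end_hausdorff : hausdorff_space E.
Proof.
move=> nu mu clnm; apply/esym/end_eq => a mua; apply: contrapT => nua.
have [b mub ba] := end_round mua.
have [nuCb|//] := end_prime nu ba.
have [||k [kCb kb]] := clnm (end_nbhd (~` b)%O) (end_nbhd b).
- by apply/nbhs_endP; exists (~` b)%O.
- by apply/nbhs_endP; exists b.
- exact: (end_compl kb).
Qed.

Hypothesis lca : local_contact rho BB.
Let rhoC := lca_contact lca.

Section EndOfFilter.
Variable w : B -> Prop.
Hypotheses (w_proper : ~ w \bot%O)
  (w_meet : forall a b, w a -> w b -> w (a `&` b)%O)
  (w_bounded : exists2 k, BB k & w k)
  (w_prime : forall a b, well_inside rho a b -> w (~` a)%O \/ w b).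

Let shrink a : Prop := exists b, [/\ BB b, w b & well_inside rho b a].

(** A filter with the decision property may fail to be round; the elements lying
    well above one of its bounded members form a round one. Restricting to
    bounded members makes the interpolation axiom (BC1) available. *)
Lemma end_of_filter : exists nu : E, forall a, nu a <-> shrink a.
Proof.
have BBle := ideal_le (lca_ideal lca).
have s_proper : ~ shrink \bot%O.
  move=> [b [_ wb /(well_inside_le rhoC)]]; rewrite lex0 => /eqP b0.
  by apply: w_proper; rewrite -b0.
have s_meet a b : shrink a -> shrink b -> shrink (a `&` b)%O.
  move=> [a' [Ba' wa' a'a]] [b' [Bb' wb' b'b]]; exists (a' `&` b')%O; split.
  - by apply: BBle Ba'; exact: leIl.
  - exact: w_meet.
  - apply: (well_inside_meetr rhoC).
      by apply: well_inside_mono a'a => //; exact: leIl.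
    by apply: well_inside_mono b'b => //; exact: leIr.
have s_le a b : (a <= b)%O -> shrink a -> shrink b.
  move=> ab [c [Bc wc ca]]; exists c; split=> //.
  exact: well_inside_mono ca.
have s_round a : shrink a -> exists2 b, shrink b & well_inside rho b a.
  move=> [c [Bc wc ca]]; have [b Bb [cb ba]] := lca_BC1 lca Bc ca.
  by exists b => //; exists c.
have s_bounded : exists2 a, BB a & shrink a.
  have [k Bk wk] := w_bounded.
  have [b Bb [kb _]] := lca_BC1 lca Bk (well_insidex1 rhoC k).
  by exists b => //; exists k.
have s_prime a b : well_inside rho a b -> shrink (~` a)%O \/ shrink b.
  move=> ab; have [k Bk [k' [Bk' wk' k'k]]] := s_bounded.
  have Bak : BB (a `&` k)%O by apply: BBle Bk; exact: leIr.
  have akb : well_inside rho (a `&` k)%O b.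
    by apply: well_inside_mono ab => //; exact: leIl.
  have [p Bp [akp pb]] := lca_BC1 lca Bak akb.
  have [q Bq [pq qb]] := lca_BC1 lca Bp pb.
  have [wCp|wq] := w_prime pq; last by right; exists q.
  (* As [a] may be unbounded, interpolation applies to [a `&` k] only: the
     complement of [p] is far from [a `&` k], and [k'] is far from the
     complement of [k]. *)
  left; exists (k' `&` ~` p)%O; split.
  - by apply: BBle Bk'; exact: leIl.
  - exact: w_meet.
  - apply: (well_inside_mono rhoC (lexx _) (b := ~` (a `&` k) `&` k)%O).
      by rewrite complI meetUl meetCx joinx0 leIl.
    apply: (well_inside_meetr rhoC).
      apply: (well_inside_mono rhoC (leIr _ _) (lexx _)).
      exact: well_inside_compl.
    exact: (well_inside_mono rhoC (leIl _ _) (lexx _)).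
by exists (MkEnd s_proper s_meet s_le s_round s_bounded s_prime).
Qed.

End EndOfFilter.

(** The points adherent to [a], those whose neighbourhoods all overlap [a]. *)
Definition end_closure (a : B) : set E := [set nu | ~ nu (~` a)%O].

Lemma end_closureS a b : (a <= b)%O -> end_closure a `<=` end_closure b.
Proof. by move=> ab nu nua nub; apply: nua; apply: end_le nub; rewrite leC. Qed.

Lemma end_closure_nbhd a b :
  well_inside rho a b -> end_closure a `<=` end_nbhd b.
Proof. by move=> ab nu nua; have [] := end_prime nu ab. Qed.

(** An ultrafilter on the space of ends induces a filter with the decision
    property on the algebra, and converges to the end obtained from it. *)
Lemma compact_end_closure a : BB a -> compact (end_closure a).
Proof.
move=> Ba; rewrite compact_ultra => U UU Ua.
have [k Bk [ak _]] := lca_BC1 lca Ba (well_insidex1 rhoC a).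
have [||||nu nuP] := @end_of_filter (fun h => U (end_nbhd h)).
- suff -> : end_nbhd \bot%O = set0 by exact: filter_not_empty.
  by rewrite -subset0 => mu; exact: end_proper.
- move=> b c Ub Uc; apply: filterS (filterI Ub Uc) => mu [mub muc].
  exact: end_meet.
- by exists k => //; apply: filterS Ua; exact: end_closure_nbhd.
- move=> b c bc; have [Uc|Uc] := in_ultra_setVsetC (end_nbhd c) UU.
    by right.
  by left; apply: filterS Uc => mu muc; have [] := end_prime mu bc.
exists nu; split.
  move=> /nuP[h [Bh Uh ha]].
  have Uah : U (end_closure a `&` end_nbhd h) by exact: filterI.
  have [mu [mua muh]] := filter_ex Uah.
  by apply: mua; apply: end_le muh; exact: well_inside_le ha.
move=> V /nbhs_endP[b /nuP[h [Bh Uh hb]] bV]; apply: filterS Uh => mu muh.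
by apply: bV; apply: end_le muh; exact: well_inside_le hb.
Qed.

Lemma end_locally_compact : locally_compact [set: E].
Proof.
move=> nu _; rewrite withinET; have [a Ba nua] := end_bounded nu.
have cK := compact_end_closure Ba; exists (end_closure a).
  by apply/nbhs_endP; exists a => // mu mua; exact: end_compl.
by split=> //; exact: compact_closed (@end_hausdorff) cK.
Qed.

End EndSpace.

Arguments end_hausdorff {d B} rho BB.
Arguments end_locally_compact {d B rho BB} lca : rename.

(** * The extension of an admissible local contact algebra *)

Section ExtOfLad.
Variables (X : topologicalType) (hX : tychonoff_space X) (l : Lad X).
Notation rho := (Lad_rel l).
Notation BB := (Lad_bounded l).
Notation E := (lca_end rho BB).
Let lca := Lad_lca l.
Let rhoC := lca_contact lca.

Lemma RC_neighborhood (x : X) (U : set X) : nbhs x U ->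
  exists2 F : RC X, (F : set X)° x & F `<=` U.
Proof.
move=> xU; have [V xV VU] := completely_regular_regular_space hX.2 xU.
exists (MkRC (regclosed_closure_int V)) => /=.
  rewrite /interior/=; apply: filterS (nbhs_interior xV); exact: subset_closure.
by apply: subset_trans VU; apply: closureS; exact: interior_subset.
Qed.

Section PointEnd.
Variable x : X.
Let mem (F : RC X) : Prop := (F : set X)° x.

Let point_proper : ~ mem \bot%O.
Proof. by move=> /interior_subset. Qed.

Let point_meet F G : mem F -> mem G -> mem (F `&` G)%O.
Proof. by move=> Fx Gx; exact: int_RC_meet. Qed.

Let point_le F G : (F <= G)%O -> mem F -> mem G.
Proof. by move=> /RC_leP FG; exact: interiorS. Qed.

Let point_round F : mem F -> exists2 G, mem G & well_inside rho G F.
Proof. by move=> /(Lad_admissible l).2[G _ []]; exists G. Qed.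

Let point_bounded : exists2 F, BB F & mem F.
Proof.
have [|G BG [Gx _]] := (Lad_admissible l).2 \top%O x.
  by rewrite interiorT.
by exists G.
Qed.

Let point_prime F G : well_inside rho F G -> mem (~` F)%O \/ mem G.
Proof.
move=> FG; rewrite {1}/mem int_RC_compl.
have [Fx|] := pselect ((F : set X) x); [right|by left].
rewrite -[G]complK /mem int_RC_compl => CGx.
by apply: FG; apply: (Lad_admissible l).1; exists x.
Qed.

Definition point_end : E := MkEnd point_proper point_meet point_le point_round
  point_bounded point_prime.

End PointEnd.

Lemma point_end_nbhd (F : RC X) : point_end @^-1` end_nbhd F = (F : set X)°.
Proof. by []. Qed.

Lemma point_end_continuous : continuous point_end.
Proof.
move=> x U /nbhs_endP[F Fx FU].
by apply: filterS (nbhs_interior Fx) => z Fz; exact: FU.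
Qed.

(** The base set of [F] pulls back to the interior of [F], and these interiors
    form a base of [X] because [X] is regular. *)
Lemma point_end_embedding : embedding point_end.
Proof.
have inj : injective point_end.
  move=> x y xy; apply: hX.1 => A A' xA yA'.
  have [F Fx FA] := RC_neighborhood xA.
  have Fy : end_nbhd F (point_end y) by rewrite -xy.
  exists y; split; last exact: nbhs_singleton.
  by apply: FA; exact: interior_subset Fy.
split=> //; first exact: point_end_continuous.
move=> U oU; exists (\bigcup_(F in [set F : RC X | F `<=` U]) end_nbhd F).
  by apply: bigcup_open => F _; exact: open_end_nbhd.
rewrite eqEsubset; split=> [_ [x Ux <-]|_ [[x _ <-] [F FU Fx]]].
  split; first by exists x.
  have [F Fx FU] := RC_neighborhood (open_nbhs_nbhs (conj oU Ux)).
  by exists F.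
by exists x => //; apply: FU; exact: interior_subset Fx.
Qed.

Lemma point_end_dense : dense (range point_end).
Proof.
move=> O [nu Onu] oO.
have /nbhs_endP[F nuF FO] := open_nbhs_nbhs (conj oO Onu).
have /RC_neq0[x Fx] : F != \bot%O.
  by apply/eqP => F0; apply: (end_proper (l := nu)); rewrite -F0.
by exists (point_end x); split; [exact: FO|exists x].
Qed.

Lemma closure_point_end (F : RC X) :
  closure (point_end @` F) = end_closure F.
Proof.
rewrite eqEsubset; split=> nu.
  move=> clnu nuCF.
  have [|_ [[x Fx <-]]] := clnu (end_nbhd (~` F)%O).
    by apply/nbhs_endP; exists (~` F)%O.
  by rewrite -[end_nbhd _ _]/((point_end @^-1` end_nbhd _) x) point_end_nbhd
    int_RC_compl.
move=> nuF U /nbhs_endP[G nuG GU]; apply: contrapT => nFG; apply: nuF.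
apply: end_le nuG; rewrite lexC; apply/RC_leP => x Fx.
rewrite [X in X x]closure_setC => Gx; apply: nFG.
by exists (point_end x); split; [exists x|exact: GU].
Qed.

Definition ext_of_Lad : lch_ext X :=
  MkExt (end_hausdorff rho BB) (end_locally_compact lca) point_end_embedding
    point_end_dense.

(** For the direct implication, (BC2) replaces [G] by a bounded [C `&` G], whose
    closure is compact. If it missed the closure of [F], it would be covered by
    the directed family of the base sets of elements well inside the complement
    of [F], hence by one of them, and then [C `&` G] would be far from [F]. *)
Lemma Lad_relP (F G : RC X) :
  rho F G <-> (end_closure F : set E) `&` end_closure G !=set0.
Proof.
split=> [FG|[nu [nuF nuG]]]; last first.
  apply: contrapT => nFG.
  have [|//|//] := @end_prime _ _ _ _ nu F (~` G)%O.
  by rewrite /well_inside complK.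
have [C BC FCG] := lca_BC2 lca FG.
have BCG : BB (C `&` G)%O by apply: (ideal_le (lca_ideal lca)) BC; exact: leIl.
apply: contrapT => dis.
have [|H _|H K /= HF KF|nu nuCG|H /= HF CGH] := @compact_directed_cover _ _
    [set H | well_inside rho H (~` F)%O] (@end_nbhd _ _ rho BB) _
    (compact_end_closure lca BCG).
- exists \bot%O; rewrite /= /well_inside => /(contact_neq0 rhoC)[].
  by rewrite eqxx.
- exact: open_end_nbhd.
- exists (H `|` K)%O; first exact: well_inside_joinl.
  by move=> nu [nuH|nuK] /=; [apply: end_le nuH|apply: end_le nuK];
    rewrite ?leUl ?leUr.
- have : nu (~` F)%O.
    apply: contrapT => nuF; apply: dis; exists nu; split=> //.
    by apply: end_closureS nuCG; exact: leIr.
  by move=> /end_round[H nuH HF]; exists H.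
have CGleH : (C `&` G <= H)%O.
  apply/RC_leP => x CGx; suff : (H : set X)° x by exact: interior_subset.
  have : end_closure (C `&` G)%O (point_end x).
    by rewrite -closure_point_end; apply: subset_closure; exists x.
  by move=> /CGH.
have := well_inside_mono rhoC CGleH (lexx _) HF.
by apply; rewrite complK; exact: (contact_sym rhoC).
Qed.

(** Every end contains a bounded element, so a compact closure lies in the base
    set of one of them, which then dominates [F]. *)
Lemma Lad_boundedP (F : RC X) :
  BB F <-> compact (end_closure F : set E).
Proof.
split=> [|cF]; first exact: compact_end_closure.
have [|H _|H K BH BK|nu _|H BH FH] :=
  @compact_directed_cover _ _ BB (@end_nbhd _ _ rho BB) _ cF.
- by exists \bot%O; exact: ideal0 (lca_ideal lca).
- exact: open_end_nbhd.
- exists (H `|` K)%O; first exact: (ideal_join (lca_ideal lca)).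
  by move=> nu [nuH|nuK] /=; [apply: end_le nuH|apply: end_le nuK];
    rewrite ?leUl ?leUr.
- by have [a Ba nua] := end_bounded nu; exists a.
apply: (ideal_le (lca_ideal lca)) BH; apply/RC_leP => x Fx.
suff : (H : set X)° x by exact: interior_subset.
have : end_closure F (point_end x).
  by rewrite -closure_point_end; apply: subset_closure; exists x.
by move=> /FH.
Qed.

Lemma Lad_of_ext_of_Lad : Lad_of_ext ext_of_Lad = l.
Proof.
by apply: Lad_le_anti; split=> [F G|F];
  rewrite /= /ext_rel /ext_bounded /ext_closure /= !closure_point_end;
  move=> /Lad_relP || move=> /Lad_boundedP.
Qed.

End ExtOfLad.

(** * The isomorphism *)

Theorem theorem2p2 (X : topologicalType) (hX : tychonoff_space X) :
  poset_isomorphic (Lcal_poset X) (Lad_poset X).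
Proof.
pose phi (c : Lcal_poset X) : Lad_poset X :=
  Lad_of_ext (projT1 (cid (Lcal_of_surj c))).
have phiE c : exists2 e, c = Lcal_of e & phi c = Lad_of_ext e.
  by rewrite /phi; case: cid => e /= ->; exists e.
have phi_le c1 c2 : poset_le c1 c2 <-> poset_le (phi c1) (phi c2).
  have [e1 -> ->] := phiE c1; have [e2 -> ->] := phiE c2.
  rewrite /= Lcal_leE; split; first exact: Lad_of_ext_mono.
  exact: ext_le_of_Lad_le.
have phi_inj c1 c2 : phi c1 = phi c2 -> c1 = c2.
  move=> c12; apply: poset_anti; apply/phi_le; rewrite c12; exact: poset_refl.
pose psi (l : Lad_poset X) : Lcal_poset X := Lcal_of (ext_of_Lad hX l).
have psiK : cancel psi phi.
  move=> l; have [e /Lcal_of_eq/ext_equiv_sym le ->] := phiE (psi l).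
  rewrite -[RHS](Lad_of_ext_of_Lad hX); apply: Lad_le_anti.
    exact/Lad_of_ext_mono/ext_equiv_le.
  exact/Lad_of_ext_mono/ext_equiv_le/ext_equiv_sym.
exists phi; split=> //; exists psi => // c; exact/phi_inj/psiK.
Qed.
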